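(* The construction below is well defined (at every step $i$ and for every $t\neq s$ the required set $S_{i-1}^t$ exists), and $H_p$ is a single-source $p$-multipath preserver of $G$ with exactly $p(n-1)$ edges. More precisely, $s$ has in-degree $0$ in $H_p$ and every other vertex has in-degree $p$ in $H_p$.
   Context: Let $G$ be a directed graph with $n$ vertices, vertex set $V(G)$, edge set $E(G)$, non-negative edge costs $c$; $G$ is anti-symmetric (if $(u,v)\in E(G)$ then $(v,u)\notin E(G)$). The cost of a path or edge set is the sum of its edge costs. Fix a source $s$ and an integer $p\ge 1$ such that $G$ is $p$-edge-outconnected from $s$ (for every $t\neq s$ there are $p$ pairwise edge-disjoint $s$–$t$ paths in $G$). A single-source $p$-multipath preserver of $G$ is a subgraph $H$ of $G$ such that for every $t\neq s$, $H$ contains $p$ pairwise edge-disjoint $s$–$t$ paths whose total cost is minimum among all families of $p$ pairwise edge-disjoint $s$–$t$ paths in $G$. Construction: $H_0=(V(G),\emptyset)$. For $i=1,\dots,p$: for each $t\neq s$ let $S_{i-1}^t$ be the edge set of $i-1$ pairwise edge-disjoint $s$–$t$ paths contained in $H_{i-1}$ whose total cost is minimum among all families of $i-1$ edge-disjoint $s$–$t$ paths in $G$ ($S_0^t=\emptyset$); let $G_{i-1}^t$ be obtained from $G$ by replacing each $(u,v)\in S_{i-1}^t$ by $(v,u)$ with cost $-c(u,v)$. For a path $\pi$ let $\eta(\pi)$ be the number of edges of $\pi$ in $E(G)\setminus E(H_{i-1})$ (original orientation) and compare paths lexicographically by $(c(\pi),\eta(\pi))$; let $\Pi(s,t;G_{i-1}^t)$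 be the set of $s$–$t$ paths in $G_{i-1}^t$ minimal in this order. For each $t\neq s$ choose arbitrarily $\pi_t\in\Pi(s,t;G_{i-1}^t)$ with last edge $e_t$, and let $H_i$ be $H_{i-1}$ plus all edges $e_t$, $t\ne s$. *)

(* Defs.v *)
From mathcomp Require Import all_boot all_order all_algebra.

Set Implicit Arguments.
Unset Strict Implicit.
Unset Printing Implicit Defensive.

Import Order.TTheory GRing.Theory Num.Theory.
Local Open Scope ring_scope.

(* A directed graph with vertex set T is its set of edges, the pair (u, v)
   being the edge from u to v.  Subgraphs are always taken spanning. *)

Section Digraph.
Variable T : finType.
Implicit Types (G H : {set T * T}) (x y s t : T) (q : seq T) (P : seq (seq T)).

Definition antisymmetric_digraph G : Prop :=
  forall u v, (u, v) \in G -> (v, u) \notin G.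

(* The path x -> q_0 -> q_1 -> ... is represented by x and q, the start x
   being omitted from q; paths do not repeat vertices. *)
Definition is_path G x y q : bool :=
  [&& path (fun u v => (u, v) \in G) x q, uniq (x :: q) & last x q == y].

Definition path_edges x q : seq (T * T) := zip (x :: q) q.

(* The default (x, x) is only returned on the empty path from x to x. *)
Definition last_edge x q : T * T := last (x, x) (path_edges x q).

Definition edge_disjoint x q1 q2 : bool :=
  ~~ has (mem (path_edges x q1)) (path_edges x q2).

Definition disjoint_paths G s t k P : bool :=
  [&& size P == k, all (is_path G s t) P & pairwise (edge_disjoint s) P].

Definition family_edges s P : {set T * T} :=
  [set a | has (fun q => a \in path_edges s q) P].

Definition edge_outconnected G s k : Prop :=
  forall t, t != s -> exists P, disjoint_paths G s t k P.

Definition in_degree G v : nat := #|[set a in G | a.2 == v]|.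

End Digraph.

Section Costs.
Variables (R : realDomainType) (T : finType).
Implicit Types (c : T * T -> R) (G H S : {set T * T}) (s t : T) (k : nat).
Implicit Types (q : seq T) (P Q : seq (seq T)).

Definition path_cost c s q : R := \sum_(a <- path_edges s q) c a.

Definition family_cost c s P : R := \sum_(q <- P) path_cost c s q.

(* The paths lie in H, whereas minimality is among all families in G. *)
Definition min_disjoint_paths c G H s t k P : Prop :=
  disjoint_paths H s t k P /\
  forall Q, disjoint_paths G s t k Q -> family_cost c s P <= family_cost c s Q.

Definition multipath_preserver c G s k H : Prop :=
  H \subset G /\ forall t, t != s -> exists P, min_disjoint_paths c G H s t k P.

Definition min_edge_set c G H s t k S : Prop :=
  exists2 P, min_disjoint_paths c G H s t k P & S = family_edges s P.

Definition rev_edge (a : T * T) : T * T := (a.2, a.1).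

Definition residual G S : {set T * T} :=
  (G :\: S) :|: [set rev_edge a | a in S].

(* For S \subset G with G antisymmetric, an edge of the residual graph has its
   reverse in S exactly when it is a reversed edge. *)
Definition residual_cost c S (a : T * T) : R :=
  if rev_edge a \in S then - c (rev_edge a) else c a.

(* Number of edges of the path in G but not in H.  When S \subset H and G is
   antisymmetric, reversed edges of the residual graph are never counted. *)
Definition new_edges G H s q : nat :=
  count (mem (G :\: H)) (path_edges s q).

Definition lex_le (x y : R * nat) : bool :=
  (x.1 < y.1) || (x.1 == y.1) && (x.2 <= y.2)%N.

Definition lex_min_path c G H S s t q : Prop :=
  let key r := (path_cost (residual_cost c S) s r, new_edges G H s r) in
  is_path (residual G S) s t q /\
  forall r, is_path (residual G S) s t r -> lex_le (key q) (key r).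

(* H' is a possible H_{k+1} when H is H_k.  The choices made for S t and q t
   are arbitrary, and made independently for each t. *)
Definition construction_step c G s k H H' : Prop :=
  exists (S : T -> {set T * T}) (q : T -> seq T),
    (forall t, t != s ->
       min_edge_set c G H s t k (S t) /\ lex_min_path c G H (S t) s t (q t)) /\
    H' = H :|: [set last_edge s (q t) | t in [set~ s]].

Inductive constructed c G s : nat -> {set T * T} -> Prop :=
| Constructed0 : constructed c G s 0 set0
| ConstructedS k H H' :
    constructed c G s k H -> construction_step c G s k H H' ->
    constructed c G s k.+1 H'.

End Costs.

(* Main.v *)
(* Idea.  Weigh an edge a by (c a, [a is new]), ordered lexicographically, where
   new means in G but not in H_k.  For each t, S^t is a minimum flow of value k,
   so its residual graph has no negative cycle and the distances phi_t from s are
   a potential certifying optimality of S^t, and of S^t augmented along any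
   shortest path.  Suppose that a shortest path pi to y in the residual graph of
   S^t ends with a new edge e.  Augment S^t along pi to get K, and S^y along pi_y
   to get F.  If e is not the chosen edge e_y, then F - K contains a cycle through
   the reverse of e; it has weight zero, being residual for K and, reversed, for
   F.  Its edges are therefore tight for phi_t and phi_y, and counting new edges
   by phi_y along it shows that it contains e_y.  Hence e_y too ends a shortest
   path to y for S^t.  By induction on the number of new edges some shortest path
   to t in the residual graph of S^t has all its new edges in H_(k+1), and
   augmenting S^t along it yields k+1 disjoint paths of minimum cost.  The
   in-degrees follow because the k in-edges of t in H_k are all used by S^t, so
   that e_t is new. *)
Require Import Defs.
From mathcomp Require Import all_boot all_order all_algebra.
From mathcomp Require Import zify.

Set Implicit Arguments.
Unset Strict Implicit.
Unset Printing Implicit Defensive.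

Import Order.TTheory GRing.Theory Num.Theory.
Local Open Scope ring_scope.

(** * The lexicographic order on pairs *)

Section LexOrder.
Variable R : realDomainType.
Implicit Types x y z : R * int.

(** The positive cone of the lexicographic order on the group [R * int]. The second coordinate is an
    integer so that weights can be negated on reversed edges. *)
Definition lex_ge0 x : bool := (0 < x.1) || (x.1 == 0) && (0 <= x.2).

Lemma lex_ge00 : lex_ge0 0.
Proof. by rewrite /lex_ge0 /= eqxx lexx orbT. Qed.

Lemma lex_ge0D x y : lex_ge0 x -> lex_ge0 y -> lex_ge0 (x + y).
Proof.
case: x y => [a m] [b n]; rewrite /lex_ge0 /=.
case/orP=> [a0|/andP[/eqP-> m0]]; case/orP=> [b0|/andP[/eqP-> n0]].
- by rewrite addr_gt0.
- by rewrite addr0 a0.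
- by rewrite add0r b0.
- by rewrite addr0 eqxx addr_ge0 // orbT.
Qed.

Lemma lex_ge0_anti x : lex_ge0 x -> lex_ge0 (- x) -> x = 0.
Proof.
case: x => [a m]; rewrite /lex_ge0 /= !oppr_gt0 !oppr_eq0 !oppr_ge0.
case: (ltgtP a 0) => //= -> m0 m0'.
by congr (_, _); apply/eqP; rewrite eq_le m0 m0'.
Qed.

Lemma lex_ge0_total x : lex_ge0 x || lex_ge0 (- x).
Proof.
case: x => [a m]; rewrite /lex_ge0 /= !oppr_gt0 !oppr_eq0 !oppr_ge0.
by case: (ltgtP a 0) => //= _; exact: le_total.
Qed.

Lemma lex_ge0_fst x : lex_ge0 x -> 0 <= x.1.
Proof. by case/orP=> [/ltW|/andP[/eqP->]]. Qed.

Lemma lex_ge0_sum I (r : seq I) (P : pred I) (F : I -> R * int) :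
  (forall i, P i -> lex_ge0 (F i)) -> lex_ge0 (\sum_(i <- r | P i) F i).
Proof. by move=> F0; elim/big_ind: _ => //; [exact: lex_ge00|exact: lex_ge0D]. Qed.

(** Turns zero total slack along a path or closed walk into zero slack on every edge. *)
Lemma lex_sum_eq0 (I : eqType) (r : seq I) (F : I -> R * int) :
  (forall i, i \in r -> lex_ge0 (F i)) -> \sum_(i <- r) F i = 0 ->
  forall i, i \in r -> F i = 0.
Proof.
elim: r => // j r IH F0; rewrite big_cons => S0.
have Fj0 : lex_ge0 (F j) by rewrite F0 ?mem_head.
have Fr i : i \in r -> lex_ge0 (F i) by move=> ir; rewrite F0 // inE ir orbT.
have Sr0 : lex_ge0 (\sum_(i <- r) F i).
  by rewrite big_seq; apply: lex_ge0_sum.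
have Fj : F j = 0.
  by apply: lex_ge0_anti => //; rewrite (addr0_eq S0).
move=> i; rewrite inE => /orP[/eqP-> //|]; apply: IH => //.
by move: S0; rewrite Fj add0r.
Qed.

Lemma sum_pair I (r : seq I) (P : pred I) (f : I -> R) (g : I -> int) :
  \sum_(i <- r | P i) (f i, g i)
    = (\sum_(i <- r | P i) f i, \sum_(i <- r | P i) g i).
Proof. by elim/big_rec3: _ => // i x y z _ ->. Qed.

Lemma sum_fst I (r : seq I) (P : pred I) (F : I -> R * int) :
  (\sum_(i <- r | P i) F i).1 = \sum_(i <- r | P i) (F i).1.
Proof. by elim/big_rec2: _ => //= i x y _ <-. Qed.

Lemma sum_snd I (r : seq I) (P : pred I) (F : I -> R * int) :
  (\sum_(i <- r | P i) F i).2 = \sum_(i <- r | P i) (F i).2.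
Proof. by elim/big_rec2: _ => //= i x y _ <-. Qed.

End LexOrder.

(** * Edge-disjoint paths and flows *)

Section Paths.
Variable T : finType.
Implicit Types (G H K S L : {set T * T}) (x y s t v : T) (q : seq T).
Implicit Types (P : seq (seq T)) (a : T * T).

Lemma rev_edgeK : involutive (@rev_edge T).
Proof. by case. Qed.

Lemma path_edges_cons x y q :
  path_edges x (y :: q) = (x, y) :: path_edges y q.
Proof. by []. Qed.

Lemma path_edges_cat x q1 q2 :
  path_edges x (q1 ++ q2) = path_edges x q1 ++ path_edges (last x q1) q2.
Proof. by elim: q1 x => //= y q1 IH x; rewrite !path_edges_cons IH. Qed.

Lemma path_edges_rcons x q y :
  path_edges x (rcons q y) = rcons (path_edges x q) (last x q, y).
Proof. by rewrite -cats1 path_edges_cat -cats1. Qed.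

Lemma heads_path_edges x q : map snd (path_edges x q) = q.
Proof. by elim: q x => // y q IH x; rewrite path_edges_cons /= IH. Qed.

Lemma tails_path_edges x q : map fst (path_edges x q) = belast x q.
Proof. by elim: q x => // y q IH x; rewrite path_edges_cons /= IH. Qed.

Lemma uniq_path_edges x q : uniq q -> uniq (path_edges x q).
Proof. by rewrite -{1}(heads_path_edges x q); apply: map_uniq. Qed.

Lemma path_edges_head x q a : a \in path_edges x q -> a.2 \in q.
Proof. by move=> aq; rewrite -(heads_path_edges x q) map_f. Qed.

Lemma path_edges_tail x q a :
  uniq (x :: q) -> a \in path_edges x q -> a.1 != last x q.
Proof.
rewrite lastI rcons_uniq => /andP[lq _] aq.
apply: contraNneq lq => <-.
by rewrite -(tails_path_edges x q) map_f.
Qed.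

Lemma pathE G x q :
  path (fun u v => (u, v) \in G) x q = all (mem G) (path_edges x q).
Proof. by elim: q x => // y q IH x; rewrite path_edges_cons /= IH. Qed.

Lemma telescope (V : zmodType) (h : T -> V) x q :
  \sum_(a <- path_edges x q) (h a.1 - h a.2) = h x - h (last x q).
Proof.
elim: q x => [|y q IH] x /=; first by rewrite big_nil subrr.
by rewrite path_edges_cons big_cons IH addrA subrK.
Qed.

Lemma last_edge_rcons x q y : last_edge x (rcons q y) = (last x q, y).
Proof. by rewrite /last_edge path_edges_rcons last_rcons. Qed.

Lemma last_edgeP x y q : x != y -> last x q = y ->
  last_edge x q \in path_edges x q /\ (last_edge x q).2 = y.
Proof.
move=> xy; case: (lastP q) => [|{}q z].
  by move=> /= exy; rewrite exy eqxx in xy.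
by rewrite last_rcons last_edge_rcons path_edges_rcons mem_rcons mem_head => ->.
Qed.

Lemma into_last x q a :
  uniq (x :: q) -> a \in path_edges x q -> a.2 = last x q -> a = last_edge x q.
Proof.
case: (lastP q) => [|{}q z] //.
rewrite last_rcons last_edge_rcons path_edges_rcons mem_rcons inE.
move=> /= /andP[_]; rewrite rcons_uniq => /andP[zq _].
case/orP=> [/eqP//|/path_edges_head aq az].
by rewrite az (negPf zq) in aq.
Qed.

(* An edge set of divergence [k] at [s], [-k] at [t] and [0] elsewhere, tested
   against all potentials [h] with values in any abelian group. *)
Definition is_flow K s t k : Prop :=
  forall (V : zmodType) (h : T -> V),
    \sum_(a in K) (h a.1 - h a.2) = (h s - h t) *+ k.

Lemma sum_family_edges (V : nmodType) (g : T * T -> V) s P :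
  all uniq P -> pairwise (edge_disjoint s) P ->
  \sum_(a in family_edges s P) g a = \sum_(q <- P) \sum_(a <- path_edges s q) g a.
Proof.
elim: P => [|q P IH] /=.
  by rewrite big_nil big_pred0 // => a; rewrite inE.
move=> /andP[uq uP] /andP[/allP dq dP]; rewrite big_cons -IH //.
rewrite [X in _ = X + _]big_uniq ?uniq_path_edges //=.
rewrite -bigU /=; last first.
  rewrite disjoint_subset; apply/subsetP => a aq; rewrite !inE.
  apply/hasP => -[r /dq /hasPn dr /dr]; rewrite /= aq //.
by apply: eq_bigl => a; rewrite !inE.
Qed.

Lemma disjoint_paths_flow G s t k P :
  disjoint_paths G s t k P -> is_flow (family_edges s P) s t k.
Proof.
move=> /and3P[/eqP sP /allP GP dP] V h.
rewrite sum_family_edges //; last first.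
  by apply/allP => q /GP /and3P[_ /andP[]].
transitivity (\sum_(q <- P) (h s - h t)); last first.
  by rewrite big_const_seq count_predT sP iter_addr_0.
rewrite big_seq [RHS]big_seq.
by apply: eq_bigr => q /GP /and3P[_ _ /eqP lq]; rewrite telescope lq.
Qed.

Lemma disjoint_paths_sub G s t k P :
  disjoint_paths G s t k P -> family_edges s P \subset G.
Proof.
move=> /and3P[_ /allP GP _]; apply/subsetP => a; rewrite inE.
by case/hasP=> q /GP /and3P[]; rewrite pathE => /allP qG _ _ /qG.
Qed.

Lemma sub_disjoint_paths G G' s t k P :
  G \subset G' -> disjoint_paths G s t k P -> disjoint_paths G' s t k P.
Proof.
move=> /subsetP sG /and3P[sP GP dP]; apply/and3P; split=> //.
apply: sub_all GP => q /and3P[pq uq lq]; apply/and3P; split=> //.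
by apply: sub_path pq => u v /=; exact: sG.
Qed.

(* The indicator of the set reachable from [s] shows that [t] belongs to it, and
   deleting a path lowers the value by one. *)
Lemma flow_disjoint_paths K s t k : s != t -> is_flow K s t k ->
  exists2 P, disjoint_paths K s t k P & family_edges s P \subset K.
Proof.
move=> st; elim: k K => [|k IH] K fK.
  by exists [::] => //; apply/subsetP => a; rewrite inE.
pose e u v := (u, v) \in K.
have /connectP[q0 q0K lq0] : connect e s t.
  apply: contraT => nt.
  have := fK int (fun v => (connect e s v : nat)%:Z).
  rewrite connect0 (negPf nt) subr0 => E.
  have : \sum_(a in K)
      ((connect e s a.1 : nat)%:Z - (connect e s a.2 : nat)%:Z) <= 0.
    apply: sumr_le0 => -[u v] uvK /=; case: (boolP (connect e s u)) => [su|_].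
      by rewrite (connect_trans su (connect1 _)).
    by case: connect.
  by rewrite E pmulrn_lle0.
case: (shortenP q0K) lq0 => q qK uq _ lq.
have pqK : {subset path_edges s q <= K}.
  by move: qK; rewrite pathE => /allP.
have uqe : uniq (path_edges s q) by apply: uniq_path_edges; case/andP: uq.
have [P dP sP] : exists2 P, disjoint_paths (K :\: [set a in path_edges s q]) s t k P
    & family_edges s P \subset K :\: [set a in path_edges s q].
  apply: IH => V h; apply: (addIr (\sum_(a <- path_edges s q) (h a.1 - h a.2))).
  rewrite [in RHS]telescope -lq -mulrSr -fK addrC.
  rewrite [RHS](big_setID [set a in path_edges s q]) /=; congr (_ + _).
  rewrite [LHS]big_uniq //; apply: eq_bigl => a; rewrite !inE.
  by apply/idP/andP => [aq|[]//]; split=> //; exact: pqK.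
have KP := sub_disjoint_paths (subsetDl _ _) dP.
exists (q :: P); last first.
  apply/subsetP => a; rewrite inE /= => /orP[/pqK//|aP].
  by have /(subsetP sP) : a \in family_edges s P; rewrite inE // => /andP[].
move: KP dP => /and3P[sizeP GP dP] /and3P[_ /allP GP' _].
apply/and3P; split=> //=; first by rewrite /is_path qK uq -lq eqxx.
rewrite dP andbT; apply/allP => r /GP' /and3P[].
rewrite pathE => /allP rK _ _; apply/hasPn => a /rK.
by rewrite !inE => /andP[].
Qed.

End Paths.

(** * Residual graphs and optimality certificates *)

Section Residual.
Variables (T : finType) (G : {set T * T}).
Hypothesis antiG : antisymmetric_digraph G.
Implicit Types (F K Q S L : {set T * T}) (x y s t v : T) (q : seq T).
Implicit Types (P : seq (seq T)) (a : T * T).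

Lemma rev_notin a : a \in G -> rev_edge a \notin G.
Proof. by case: a => u v /antiG. Qed.

Lemma in_residual S a :
  (a \in residual G S) = (a \in G) && (a \notin S) || (rev_edge a \in S).
Proof.
rewrite !inE andbC; congr (_ || _).
apply/imsetP/idP => [[b bS ->]|aS]; first by rewrite rev_edgeK.
by exists (rev_edge a); rewrite ?rev_edgeK.
Qed.

(** Generalizes [residual_cost] to any abelian group, to serve costs, lexicographic weights and
    potential differences alike. *)
Definition residual_weight (V : zmodType) (w : T * T -> V) S a : V :=
  if rev_edge a \in S then - w (rev_edge a) else w a.

Lemma residual_weight_potential (V : zmodType) (h : T -> V) S a :
  residual_weight (fun b => h b.1 - h b.2) S a = h a.1 - h a.2.
Proof. by rewrite /residual_weight /= opprB; case: ifP. Qed.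

Lemma residual_weightD (V : zmodType) (w1 w2 : T * T -> V) S a :
  residual_weight (fun b => w1 b + w2 b) S a
    = residual_weight w1 S a + residual_weight w2 S a.
Proof. by rewrite /residual_weight opprD; case: ifP. Qed.

Definition augment S L : {set T * T} :=
  (S :\: [set rev_edge a | a in L]) :|: (L :&: G).

Lemma in_augment S L a :
  (a \in augment S L)
    = (a \in S) && (rev_edge a \notin L) || (a \in L) && (a \in G).
Proof.
rewrite !inE andbC; congr (_ && ~~ _ || _).
apply/imsetP/idP => [[b bL ->]|aL]; first by rewrite rev_edgeK.
by exists (rev_edge a); rewrite ?rev_edgeK.
Qed.

Lemma augment_sub S L : S \subset G -> augment S L \subset G.
Proof.
move=> /subsetP SG; apply/subsetP => a; rewrite in_augment.
by case/orP=> /andP[] // /SG.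
Qed.

(** A reversed edge of [L] cancels its original, a forward one is added. Taking for [w] a cost or a
    potential difference gives the cost or the divergence after augmentation. *)
Lemma sum_augment (V : zmodType) (w : T * T -> V) S L :
  S \subset G -> L \subset residual G S ->
  \sum_(a in augment S L) w a
    = \sum_(a in S) w a + \sum_(a in L) residual_weight w S a.
Proof.
move=> /subsetP SG /subsetP LR.
pose back a := (a \in L) && (rev_edge a \in S).
rewrite [X in _ + X](bigID (fun a => rev_edge a \in S)) /=.
have -> : \sum_(a | back a) residual_weight w S a
    = - \sum_(a in S | rev_edge a \in L) w a.
  rewrite -sumrN (reindex_inj (inv_inj (@rev_edgeK T))) /=.
  apply: eq_big => a; first by rewrite /back rev_edgeK andbC.
  by rewrite /residual_weight => /andP[_ ->]; rewrite rev_edgeK.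
have -> : \sum_(a in L | rev_edge a \notin S) residual_weight w S a
    = \sum_(a in L | a \in G) w a.
  apply: eq_big => a; last by rewrite /residual_weight => /andP[_ /negPf->].
  case aL: (a \in L) => //=; move: (LR _ aL); rewrite in_residual.
  case: (boolP (a \in G)) => [/rev_notin nG _|_ /= -> //].
  by apply: contraNN nG; exact: SG.
(* By antisymmetry an edge of [S] is not itself residual. *)
have dSL a : a \in S -> a \in L -> false.
  move=> aS /LR; rewrite in_residual aS andbF /= => /SG.
  by rewrite (negPf (rev_notin (SG _ aS))).
rewrite (bigID (mem S)) [X in _ = X + _](bigID (fun a => rev_edge a \in L)) /=.
rewrite [X in _ = X + _]addrC -addrA addNKr.
congr (_ + _); apply: eq_bigl => a; rewrite in_augment;
  by case aS: (a \in S); case aL: (a \in L) => //=; rewrite ?andbT ?andbF ?orbF //;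
     have := dSL _ aS aL.
Qed.



Lemma path_crossing (p : pred T) x q : ~~ p x -> p (last x q) ->
  exists2 a, a \in path_edges x q & ~~ p a.1 && p a.2.
Proof.
elim: q x => [|y q IH] x /= px; first by rewrite (negPf px).
case: (boolP (p y)) => [py _|py /(IH _ py)[a aq pa]].
  by exists (x, y); rewrite ?path_edges_cons ?mem_head //= px.
by exists a; rewrite // path_edges_cons inE aq orbT.
Qed.

(** * Potentials and complementary slackness *)

Section Potentials.
Variables (R : realDomainType) (w : T * T -> R * int).
Implicit Types phi psi : T -> R * int.

Definition reduced phi a : R * int := w a + (phi a.1 - phi a.2).

Lemma sum_reduced phi K : \sum_(a in K) reduced phi a
    = \sum_(a in K) w a + \sum_(a in K) (phi a.1 - phi a.2).
Proof. exact: big_split. Qed.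

(* Complementary slackness: it certifies that [K] has the least weight among
   the edge sets of [G] with the same divergence. *)
Definition optimal K phi : Prop := forall a, a \in G ->
  (a \notin K -> lex_ge0 (reduced phi a)) /\ (a \in K -> lex_ge0 (- reduced phi a)).

Lemma residual_reduced phi S a :
  residual_weight (reduced phi) S a = residual_weight w S a + (phi a.1 - phi a.2).
Proof. by rewrite residual_weightD residual_weight_potential. Qed.

Lemma optimalP S phi : S \subset G ->
  (forall a, a \in residual G S ->
     lex_ge0 (residual_weight (reduced phi) S a))
    <-> optimal S phi.
Proof.
move=> /subsetP SG; split=> [ge0 a aG|opt a].
  split=> aS.
    have := ge0 a; rewrite in_residual aG aS => /(_ isT).
    by rewrite /residual_weight (contraNF (SG _)) // rev_notin.
  have := ge0 (rev_edge a); rewrite in_residual rev_edgeK aS orbT => /(_ isT).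
  by rewrite /residual_weight rev_edgeK aS.
rewrite in_residual /residual_weight; case: ifP => [raS _|_].
  by have [_ ->] := opt _ (SG _ raS).
by rewrite orbF => /andP[aG aS]; have [->] := opt _ aG.
Qed.

(** Only edges of reduced weight zero change status, and these satisfy both slackness conditions. *)
Lemma optimal_augment S L phi : S \subset G -> L \subset residual G S ->
  optimal S phi -> (forall a, a \in L -> residual_weight (reduced phi) S a = 0) ->
  optimal (augment S L) phi.
Proof.
move=> /subsetP SG /subsetP LR opt L0 a aG; have [opt1 opt2] := opt _ aG.
rewrite in_augment aG andbT; split.
  rewrite negb_or negb_and negbK => /andP[/orP[/opt1//|raL] _].
  case: (boolP (a \in S)) => [aS|/opt1//].
  move: (L0 _ raL); rewrite /residual_weight rev_edgeK aS => /eqP.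
  by rewrite oppr_eq0 => /eqP->; exact: lex_ge00.
case/orP=> [/andP[/opt2//]|aL].
move: (L0 _ aL); rewrite /residual_weight (contraNF (SG _)) ?rev_notin // => ->.
by rewrite oppr0; exact: lex_ge00.
Qed.

(** Equal [phi]-sums allow weights to be replaced by reduced weights; every edge on which [K] and
    [Q] differ then contributes a nonnegative amount. *)
Lemma optimal_min K Q phi : K \subset G -> Q \subset G -> optimal K phi ->
  \sum_(a in K) (phi a.1 - phi a.2) = \sum_(a in Q) (phi a.1 - phi a.2) ->
  lex_ge0 (\sum_(a in Q) w a - \sum_(a in K) w a).
Proof.
move=> /subsetP KG /subsetP QG opt E.
have -> : \sum_(a in Q) w a - \sum_(a in K) w a
    = \sum_(a in Q) reduced phi a - \sum_(a in K) reduced phi a.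
  by rewrite 2!sum_reduced E opprD addrACA subrr addr0.
rewrite [X in X - _]big_mkcond [X in _ - X]big_mkcond -sumrN -big_split.
apply: lex_ge0_sum => a _ /=.
case: ifP => aQ; case: ifP => aK; rewrite ?subr0 ?subrr ?sub0r ?lex_ge00 //.
  by have [->] := opt _ (QG _ aQ); rewrite ?aK.
by have [_ ->] := opt _ (KG _ aK).
Qed.

(* By a cut argument the reverse of [e] lies on a cycle of [F - K].  That cycle
   has weight zero since it is residual for [K] while its reverse is residual
   for [F]; so all its edges are tight for both potentials, and going round it
   the second coordinate of [psi] must climb back to its value at [e.2]. *)
Lemma exchange K F phi psi t k e :
  K \subset G -> F \subset G -> optimal K phi -> optimal F psi ->
  (forall a, a \in G -> 0 <= (w a).2) ->
  (forall h : T -> int, \sum_(a in F) (h a.1 - h a.2)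
     = \sum_(a in K) (h a.1 - h a.2) + (h t - h e.2) *+ k) ->
  e \in K -> e \notin F -> 0 < (w e).2 ->
  exists f, [/\ f \in F, f \notin K, 0 < (w f).2, (psi e.2).2 <= (psi f.2).2
              & reduced phi f = 0].
Proof.
case: e => x y /subsetP KG /subsetP FG optK optF w_ge0 div_FK eK eF we /=.
(* The graph of [F - K]: edges of [F] outside [K] forwards, edges of [K] outside [F] backwards. *)
pose d u v := ((u, v) \in F) && ((u, v) \notin K)
  || ((v, u) \in K) && ((v, u) \notin F).
have /connectP[q dq lq] : connect d x y.
  (* Otherwise no edge of [d] leaves the set reachable from [x], and [(x, y)] contributes [-1],
     whereas the divergences differ by [h t *+ k], which is nonnegative. *)
  apply: contraT => nxy; pose h v := (connect d x v : nat)%:Z.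
  have hy : h y = 0 by rewrite /h (negPf nxy).
  have := div_FK h; rewrite /= hy subr0 => E.
  have hle a : d a.1 a.2 -> h a.1 <= h a.2.
    move=> da; rewrite /h; case: (boolP (connect d x a.1)) => [xa|_].
      by rewrite (connect_trans xa (connect1 da)).
    by case: connect.
  have : \sum_(a in F) (h a.1 - h a.2) - \sum_(a in K) (h a.1 - h a.2) <= - 1.
    rewrite [X in X - _]big_mkcond [X in _ - X]big_mkcond -sumrN -big_split /=.
    rewrite (bigD1 (x, y)) //= (negPf eF) eK.
    rewrite hy {1}/h connect0 subr0 add0r -[leRHS]addr0 lerD //.
    apply: sumr_le0 => -[u v] _; case: ifP => aF; case: ifP => aK.
    - by rewrite subrr.
    - by rewrite subr0 subr_le0 (hle (u, v)) // /d aF aK.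
    - by rewrite sub0r opprB subr_le0 (hle (v, u)) // /d /= aF aK orbT.
    - by rewrite subr0.
  by rewrite E addrAC subrr add0r leNgt (lt_le_trans (y := 0)) // mulrn_wge0.
(* The reverse of [e] closes the walk [q]. The walk need not be simple, so sums run over the
   list. *)
pose L := path_edges y (x :: q).
have Ld a : a \in L -> d a.1 a.2.
  rewrite /L path_edges_cons inE => /orP[/eqP-> /=|aq].
    by rewrite /d eK eF orbT.
  move: dq; have -> : path d x q = all (fun b => d b.1 b.2) (path_edges x q).
    by elim: (q) (x) => // z r IH u; rewrite path_edges_cons /= IH.
  by move/allP/(_ _ aq).
have L_closed h : \sum_(a <- L) residual_weight (reduced h) K a
    = \sum_(a <- L) residual_weight w K a.
  under eq_bigr do rewrite residual_reduced.
  by rewrite big_split telescope /= -lq subrr addr0.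
have phi_ge0 a : a \in L -> lex_ge0 (residual_weight (reduced phi) K a).
  case: a => u v /Ld/orP[]/andP[/= H1 H2]; rewrite /residual_weight /rev_edge /=.
    rewrite (contraNF (KG _)) ?(@rev_notin (u, v)) ?FG //.
    by have [->] := optK _ (FG _ H1).
  by rewrite H1; have [_ ->] := optK _ (KG _ H1).
have psi_le0 a : a \in L -> lex_ge0 (- residual_weight (reduced psi) K a).
  case: a => u v /Ld/orP[]/andP[/= H1 H2]; rewrite /residual_weight /rev_edge /=.
    rewrite (contraNF (KG _)) ?(@rev_notin (u, v)) ?FG //.
    by have [_ ->] := optF _ (FG _ H1).
  by rewrite H1 opprK; have [->] := optF _ (KG _ H1).
have L0 : \sum_(a <- L) residual_weight w K a = 0.
  apply: lex_ge0_anti.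
    by rewrite -(L_closed phi) big_seq; apply: lex_ge0_sum.
  by rewrite -(L_closed psi) -sumrN big_seq; apply: lex_ge0_sum.
have phi0 := lex_sum_eq0 phi_ge0 (etrans (L_closed phi) L0).
have psi0 a : a \in L -> residual_weight w K a = psi a.2 - psi a.1.
  move=> aL; apply/eqP; rewrite -subr_eq0 opprB -residual_reduced -oppr_eq0.
  apply/eqP/(lex_sum_eq0 psi_le0) => //.
  by rewrite sumrN L_closed L0 oppr0.
(* The reverse of [e] lowers the second coordinate of [psi]; the rest of the walk, from [x] to [y],
   must cross back up. *)
have xy_lt : (psi x).2 < (psi y).2.
  have := psi0 (y, x); rewrite /L path_edges_cons mem_head => /(_ isT).
  rewrite /residual_weight /rev_edge /= eK => /(congr1 snd) /=; lia.
have [||[u v] aq /=] := @path_crossing (fun v => (psi y).2 <= (psi v).2) x q.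
- by rewrite -ltNge.
- by rewrite -lq.
rewrite -ltNge => /andP[lt_u le_v].
have aL : (u, v) \in L by rewrite /L path_edges_cons inE aq orbT.
have := psi0 _ aL; have := phi0 _ aL.
(* The crossing edge cannot be a reversed one, since that would have a nonpositive second weight. *)
case/orP: (Ld _ aL) => /andP[/= H1 H2]; rewrite /residual_weight /rev_edge /=.
  rewrite (contraNF (KG _)) ?(@rev_notin (u, v)) ?FG // => r0 wE.
  exists (u, v); split=> //.
  by move/(congr1 snd): wE => /= ->; rewrite subr_gt0 (lt_le_trans lt_u).
rewrite H1 => _ /(congr1 snd) /=.
have := w_ge0 _ (KG _ H1); lia.
Qed.

End Potentials.
End Residual.

Lemma is_path_tail (T : finType) (G : {set T * T}) s t q r v :
  is_path G s t (q ++ r) -> last s q = v -> is_path G s v q.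
Proof.
case/and3P; rewrite cat_path -cat_cons cat_uniq => /andP[pq _] /andP[uq _] _ lq.
by apply/and3P; split=> //; apply/eqP.
Qed.

(** * Shortest residual paths *)

Section ShortestPaths.
Variables (R : realDomainType) (T : finType) (G : {set T * T}).
Variables (c : T * T -> R) (s : T) (H : {set T * T}).
Hypotheses (antiG : antisymmetric_digraph G) (HG : H \subset G).
Implicit Types (K L S : {set T * T}) (t v : T) (q : seq T) (k : nat).

Definition edge_weight (a : T * T) : R * int := (c a, (a \in G :\: H : nat)%:Z).

(** The second coordinate needs no sign: an edge of [S] lies in [H], so neither it nor its reverse
    is new. *)
Lemma residual_edge_weight S a : S \subset H -> a \in residual G S ->
  residual_weight edge_weight S a = (residual_cost c S a, (a \in G :\: H : nat)%:Z).
Proof.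
move=> /subsetP SH; rewrite in_residual /residual_weight /residual_cost /edge_weight.
case: ifP => // raS _; have raH := SH _ raS.
have /(rev_notin antiG) : rev_edge a \in G by rewrite (subsetP HG).
by rewrite rev_edgeK !inE raH => /negPf->; rewrite andbF.
Qed.

Lemma path_residual_weight S q : S \subset H ->
  path (fun u v => (u, v) \in residual G S) s q ->
  \sum_(a <- path_edges s q) residual_weight edge_weight S a
    = (path_cost (residual_cost c S) s q, (new_edges G H s q)%:Z).
Proof.
move=> SH; rewrite pathE => /allP qR; rewrite /path_cost /new_edges.
have -> r : (count (mem (G :\: H)) r)%:Z = \sum_(a <- r) (a \in G :\: H : nat)%:Z.
  by elim: r => [|a r IH]; rewrite ?big_nil // big_cons -IH.
rewrite -sum_pair big_seq [RHS]big_seq.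
by apply: eq_bigr => a /qR; exact: residual_edge_weight.
Qed.

Lemma lex_leE (x y : R * nat) :
  lex_le x y = lex_ge0 ((y.1, y.2%:Z) - (x.1, x.2%:Z)).
Proof.
by rewrite /lex_le /lex_ge0 /= subr_gt0 subr_eq0 subr_ge0 lez_nat (eq_sym y.1).
Qed.

(** Paths are simple, hence of bounded length, so the minimum is over a finite type of bounded
    sequences. *)
Lemma lex_min_exists S v q0 : is_path (residual G S) s v q0 ->
  exists q, lex_min_path c G H S s v q.
Proof.
move=> q0P.
have szP q : is_path (residual G S) s v q -> (size q <= #|T|)%N.
  case/and3P=> _ uq _; apply: ltnW; rewrite -[X in (X <= _)%N]/(size (s :: q)).
  by rewrite -(card_uniqP uq) max_card.
pose b0 : #|T|.-bseq T := Bseq (szP _ q0P).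
pose key (r : seq T) := (path_cost (residual_cost c S) s r, new_edges G H s r).
have lex_refl : reflexive (@lex_le R).
  by move=> x; rewrite lex_leE subrr lex_ge00.
have lex_trans : transitive (@lex_le R).
  move=> y x z; rewrite !lex_leE => xy yz.
  by rewrite -[X in X - _](subrK (y.1, y.2%:Z)) -addrA lex_ge0D.
have lex_total : total (@lex_le R).
  by move=> x y; rewrite !lex_leE -[X in _ || lex_ge0 X]opprB lex_ge0_total.
case: (@extremumP _ _ (@lex_le R) b0 (fun b => is_path (residual G S) s v b)
  (fun b => key b) lex_refl lex_trans lex_total q0P) => b bP b_min.
exists b; split=> // r rP.
exact: (b_min (Bseq (szP _ rP))).
Qed.

(** * The residual graph of a minimum flow to a fixed sink *)

Section FixedSink.
Variables (t : T) (k p : nat) (S : {set T * T}).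
Hypotheses (c_ge0 : forall a, a \in G -> 0 <= c a) (ts : t != s).
Hypotheses (Smin : min_edge_set c G H s t k S) (kp : (k < p)%N).
Hypothesis Gp : edge_outconnected G s p.

Lemma min_edge_set_sub : S \subset H.
Proof. by case: Smin => P [/disjoint_paths_sub PH _] ->. Qed.

Let SH := min_edge_set_sub.
Let SG := subset_trans SH HG.

Lemma min_edge_set_flow : is_flow S s t k.
Proof. by case: Smin => P [/disjoint_paths_flow PH _] ->. Qed.

Lemma family_costE P (G' : {set T * T}) (n : nat) : disjoint_paths G' s t n P ->
  family_cost c s P = \sum_(a in family_edges s P) c a.
Proof.
case/and3P=> _ /allP GP dP; rewrite sum_family_edges //.
by apply/allP => q /GP /and3P[_ /andP[]].
Qed.

(** Decomposing [K] into paths may leave edges over, but these have nonnegative cost. *)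
Lemma min_edge_set_min K : K \subset G -> is_flow K s t k ->
  \sum_(a in S) c a <= \sum_(a in K) c a.
Proof.
move=> KG fK; have st : s != t by rewrite eq_sym.
have [P dP PK] := flow_disjoint_paths st fK.
have PG := sub_disjoint_paths KG dP.
case: Smin => P0 [dP0 minP0] SE.
rewrite {1}SE -(family_costE dP0) (le_trans (minP0 _ PG)) // (family_costE dP).
rewrite [leRHS](big_setID (family_edges s P)) /= (setIidPr PK) lerDl.
by apply: sumr_ge0 => a /setDP[/(subsetP KG) /c_ge0].
Qed.

Lemma residual_reachable v : exists q, is_path (residual G S) s v q.
Proof.
pose e u v := (u, v) \in residual G S.
case: (eqVneq v s) => [->|vs]; first by exists [::]; rewrite /is_path /= eqxx.
suff /connectP[q0 q0P lq0] : connect e s v.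
  case: (shortenP q0P) lq0 => q qP uq _ lq.
  by exists q; apply/and3P; split=> //; apply/eqP.
apply: contraT => nv; pose h u := (connect e s u : nat)%:Z.
have hv : h v = 0 by rewrite /h (negPf nv).
have hs : h s = 1 by rewrite /h connect0.
have hle a : a \in residual G S -> h a.1 <= h a.2.
  case: a => x y /= xy; rewrite /h; case: (boolP (connect e s x)) => [sx|_].
    by rewrite (connect_trans sx (connect1 xy)).
  by case: connect.
have [Q dQ] := Gp vs.
(* No residual edge leaves the reachable set, so [S] carries at least as much out of it as [Q],
   which carries [p]; but [S] carries at most [k]. *)
have : \sum_(a in family_edges s Q) (h a.1 - h a.2) <= \sum_(a in S) (h a.1 - h a.2).
  rewrite big_mkcond [leRHS]big_mkcond; apply: ler_sum => a _.
  case: ifP => aQ; case: ifP => aS //.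
    rewrite subr_le0 hle // in_residual aS andbT.
    by rewrite (subsetP (disjoint_paths_sub dQ)).
  by rewrite subr_ge0 (hle (rev_edge a)) // in_residual rev_edgeK aS orbT.
rewrite (disjoint_paths_flow dQ) min_edge_set_flow hs hv.
have : 0 <= h t by rewrite /h.
nia.
Qed.

(** Augmenting along [L] gives another flow of value [k], so minimality bounds the first coordinate;
    the second is a sum of nonnegative terms. *)
Lemma residual_closed_ge0 (L : {set T * T}) : L \subset residual G S ->
  (forall (V : zmodType) (h : T -> V), \sum_(a in L) (h a.1 - h a.2) = 0) ->
  lex_ge0 (\sum_(a in L) residual_weight edge_weight S a).
Proof.
move=> LR L0.
have : 0 <= \sum_(a in L) residual_weight c S a.
  rewrite -(lerD2l (\sum_(a in S) c a)) addr0 -(sum_augment antiG c SG LR).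
  apply: min_edge_set_min; first exact: augment_sub.
  move=> V h; rewrite (sum_augment antiG) // min_edge_set_flow.
  by under [X in _ + X]eq_bigr do rewrite residual_weight_potential; rewrite L0 addr0.
rewrite /lex_ge0 sum_fst sum_snd le_eqVlt eq_sym.
have -> : \sum_(a in L) (residual_weight edge_weight S a).1
    = \sum_(a in L) residual_weight c S a.
  by apply: eq_bigr => a _; rewrite /residual_weight; case: ifP.
case/orP=> ->//; rewrite ?orbT //=; apply/orP; right.
by apply: sumr_ge0 => a /(subsetP LR) aR; rewrite residual_edge_weight.
Qed.

(* [phi v] is the distance from [s] to [v] in the residual graph. *)
Lemma shortest_path_potential : exists phi : T -> R * int,
  [/\ optimal G edge_weight S phi, phi s = 0 &
      forall v q, lex_min_path c G H S s v q ->
        \sum_(a <- path_edges s q) residual_weight edge_weight S a = phi v].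
Proof.
have ex_q v : exists q, lex_min_path c G H S s v q.
  by have [q0 q0P] := residual_reachable v; apply: lex_min_exists q0P.
have [q qP] := fin_all_exists ex_q.
pose W r := \sum_(a <- path_edges s r) residual_weight edge_weight S a.
have W_min v r r' : lex_min_path c G H S s v r -> is_path (residual G S) s v r' ->
    lex_ge0 (W r' - W r).
  case=> rP r_min r'P; have := r_min _ r'P; rewrite lex_leE /=.
  by rewrite /W !path_residual_weight //; [case/and3P: rP|case/and3P: r'P].
have W_eq v r r' : lex_min_path c G H S s v r -> lex_min_path c G H S s v r' ->
    W r = W r'.
  move=> rP r'P; apply/eqP; rewrite -subr_eq0; apply/eqP/lex_ge0_anti.
    by apply: W_min r'P _; case: rP.
  by rewrite opprB; apply: W_min rP _; case: r'P.
exists (fun v => W (q v)); split; last by move=> v r /W_eq; apply.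
- apply/optimalP => // -[x y] xyR; rewrite residual_reduced /=.
  have [qxP _] := qP x; have /and3P[px ux /eqP lx] := qxP.
  (* If [y] is already on the path to [x], appending [(x, y)] would repeat it: the prefix up to [y]
     is compared with the shortest path, and the remainder with [(x, y)] forms a cycle of
     nonnegative weight. *)
  rewrite addrA; case: (boolP (y \in s :: q x)) => [yq|yq].
    case/splitPl: yq px ux lx qxP => q1 q2 ly px ux lx qxP.
    have -> : W (q1 ++ q2) = W q1
        + \sum_(a <- path_edges y q2) residual_weight edge_weight S a.
      by rewrite /W path_edges_cat big_cat ly.
    rewrite addrCA addrAC; apply: lex_ge0D.
      exact: W_min (qP y) (is_path_tail qxP ly).
    have uyq2 : uniq (rcons q2 y).
      move: ux; rewrite -cat_cons cat_uniq rcons_uniq => /and3P[_ /hasPn dq ->].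
      rewrite andbT; apply/negP => /dq /negP; apply; rewrite -ly; exact: mem_last.
    have q2y : path_edges y (rcons q2 y) = rcons (path_edges y q2) (x, y).
      by rewrite path_edges_rcons -lx last_cat ly.
    have := @residual_closed_ge0 [set a in path_edges y (rcons q2 y)] _ _.
    have sumL (V : zmodType) (F : T * T -> V) :
        \sum_(a in [set a in path_edges y (rcons q2 y)]) F a
          = \sum_(a <- path_edges y q2) F a + F (x, y).
      rewrite -big_rcons -q2y big_uniq ?uniq_path_edges //=.
      by apply: eq_bigl => a; rewrite inE.
    rewrite sumL addrC; apply.
      apply/subsetP => a; rewrite inE q2y mem_rcons inE => /orP[/eqP->//|aq2].
      move: px; rewrite cat_path ly => /andP[_]; rewrite pathE => /allP; exact.
    by move=> V h; rewrite sumL telescope -lx last_cat ly addrA subrK subrr.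
  have -> : residual_weight edge_weight S (x, y) + W (q x) = W (rcons (q x) y).
    by rewrite /W path_edges_rcons lx big_rcons addrC.
  apply: W_min (qP y) _; apply/and3P; split.
  - by rewrite rcons_path px lx.
  - by rewrite -rcons_cons rcons_uniq yq.
  - by rewrite last_rcons.
- have [/and3P[_ uq /eqP lq] _] := qP s.
  case: (q s) uq lq => [|z r]; first by rewrite /W big_nil.
  by move=> /andP[sq _] /= lq; have := mem_last z r; rewrite lq (negPf sq).
Qed.


Lemma no_edge_from_sink a : a \in S -> a.1 != t.
Proof.
case: Smin => P [/and3P[_ /allP GP _] _] ->; rewrite inE => /hasP[q /GP].
by case/and3P=> _ uq /eqP <-; exact: path_edges_tail.
Qed.

(** No edge of [S] leaves [t], so the divergence gives [S] exactly [k] edges into [t], as many as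
    [H] has. *)
Lemma sink_edges : in_degree H t = k ->
  [set a in S | a.2 == t] = [set a in H | a.2 == t].
Proof.
move=> Hk; apply/eqP; rewrite eqEcard; apply/andP; split.
  by apply/subsetP => a; rewrite !inE => /andP[/(subsetP SH)-> ->].
have := min_edge_set_flow (fun v => (v == t : nat)%:Z).
rewrite /= eq_sym (negPf ts) eqxx sub0r mulNrn.
have -> : \sum_(a in S) ((a.1 == t : nat)%:Z - (a.2 == t : nat)%:Z)
    = - #|[set a in S | a.2 == t]|%:Z.
  rewrite -sum1_card (big_morph Posz PoszD (erefl _)) -sumrN.
  rewrite big_mkcond [RHS]big_mkcond; apply: eq_bigr => a _; rewrite inE.
  case: (boolP (a \in S)) => //= /no_edge_from_sink /negPf->.
  by case: (a.2 == t).
move/oppr_inj; rewrite -[X in X *+ k]/(1 : int) natz => -[->].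
by rewrite -[X in (X <= _)%N]/(in_degree H t) Hk.
Qed.

(** A reversed last edge would come from an edge of [S] leaving [t], and an edge of [H] into [t]
    belongs to [S], so it is not residual. *)
Lemma last_edge_new q : in_degree H t = k -> is_path (residual G S) s t q ->
  last_edge s q \in G :\: H /\ (last_edge s q).2 = t.
Proof.
move=> Hk /and3P[]; rewrite pathE => /allP qR uq /eqP lq.
have st : s != t by rewrite eq_sym.
have [eq_ e2] := last_edgeP st lq; split=> //.
have := qR _ eq_; rewrite /= in_residual => /orP[/andP[eG eS]|/no_edge_from_sink].
  rewrite inE eG andbT; apply: contra eS => eH.
  have : last_edge s q \in [set a in H | a.2 == t] by rewrite inE eH e2 eqxx.
  by rewrite -sink_edges // inE => /andP[].
by rewrite /= e2 eqxx.
Qed.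

Definition tight phi S : {set T * T} :=
  [set a in residual G S | residual_weight (reduced edge_weight phi) S a == 0].

(** Reduced weights on a shortest path are nonnegative and telescope to zero. *)
Lemma tight_potential : exists phi : T -> R * int,
  [/\ optimal G edge_weight S phi, phi s = 0 &
      forall v q, lex_min_path c G H S s v q -> is_path (tight phi S) s v q].
Proof.
have [phi [opt phi_s dist]] := shortest_path_potential.
exists phi; split=> // v q qP; have [/and3P[pq uq lq] _] := qP.
apply/and3P; split=> //; move: pq; rewrite !pathE => /allP pq.
apply/allP => a aq; have aR : a \in residual G S := pq a aq.
rewrite /= inE aR; apply/eqP.
have ge0 b : b \in path_edges s q ->
    lex_ge0 (residual_weight (reduced edge_weight phi) S b).
  by move/pq; exact: ((optimalP antiG edge_weight phi SG).2 opt).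
apply: (lex_sum_eq0 ge0) aq.
under eq_bigr do rewrite residual_reduced.
by rewrite big_split telescope (dist v) //= (eqP lq) phi_s sub0r subrr.
Qed.

End FixedSink.

(** Along tight edges the second coordinate of [phi], the level, counts new edges. *)
Lemma tight_level phi S a : S \subset H -> a \in tight phi S ->
  (phi a.2).2 = (phi a.1).2 + (a \in G :\: H : nat)%:Z.
Proof.
move=> SH; rewrite inE residual_reduced => /andP[aR /eqP].
by rewrite residual_edge_weight // => /(congr1 snd) /=; lia.
Qed.

Lemma tight_path_level phi S q v : S \subset H ->
  path (fun x y => (x, y) \in tight phi S) s q -> v \in s :: q ->
  (phi v).2 <= (phi (last s q)).2.
Proof.
move=> SH; elim/last_ind: q => [|q y IH]; first by rewrite inE => _ /eqP->.
rewrite rcons_path last_rcons => /andP[pq yT].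
rewrite -rcons_cons mem_rcons inE => /orP[/eqP->//|vq].
by have := tight_level SH yT; have := IH pq vq => /=; lia.
Qed.

Lemma tight_residual phi S : tight phi S \subset residual G S.
Proof. by apply/subsetP => a; rewrite inE => /andP[]. Qed.

Definition augment_path S q := augment G S [set a in path_edges s q].

(** Two sinks occur because [S] is augmented towards a vertex [v] that may differ from [t]. *)
Lemma augment_path_div S t k v q : S \subset G -> is_flow S s t k ->
  is_path (residual G S) s v q ->
  forall (V : zmodType) (h : T -> V),
    \sum_(a in augment_path S q) (h a.1 - h a.2) = (h s - h t) *+ k + (h s - h v).
Proof.
move=> SG fS /and3P[]; rewrite pathE => /allP qR uq /eqP lq V h.
rewrite (sum_augment antiG) //; last by apply/subsetP => a; rewrite inE; exact: qR.
rewrite fS; congr (_ + _).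
under eq_bigr do rewrite residual_weight_potential.
rewrite -lq -telescope [RHS]big_uniq ?uniq_path_edges //; last by case/andP: uq.
by apply: eq_bigl => a; rewrite inE.
Qed.

Lemma augment_path_optimal S phi v q : S \subset G ->
  optimal G edge_weight S phi -> is_path (tight phi S) s v q ->
  optimal G edge_weight (augment_path S q) phi.
Proof.
move=> SG opt /and3P[]; rewrite pathE => /allP qT _ _.
apply: optimal_augment => //.
  by apply/subsetP => a; rewrite inE => /qT /(subsetP (tight_residual _ _)).
by move=> a; rewrite inE => /qT; rewrite /= inE => /andP[_ /eqP].
Qed.

Lemma sub_is_path (G1 G2 : {set T * T}) v q :
  G1 \subset G2 -> is_path G1 s v q -> is_path G2 s v q.
Proof.
move=> /subsetP sG /and3P[pq uq lq]; apply/and3P; split=> //.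
by apply: sub_path pq => x y /=; exact: sG.
Qed.

(* The edge provided by [exchange] is a new edge of [q2] whose head is at least
   as far as [y] in number of new edges, so that it is the last one. *)
Lemma last_edge_exchange S1 S2 phi psi t y k q1 q2 :
  S1 \subset H -> S2 \subset H -> is_flow S1 s t k -> is_flow S2 s y k ->
  optimal G edge_weight S1 phi -> optimal G edge_weight S2 psi -> s != y ->
  is_path (tight phi S1) s y q1 -> is_path (tight psi S2) s y q2 ->
  last_edge s q1 \in G :\: H -> last_edge s q2 \in G :\: H ->
  last_edge s q2 \in tight phi S1.
Proof.
move=> SH1 SH2 f1 f2 opt1 opt2 sy q1T q2T new1 new2.
have [SG1 SG2] := (subset_trans SH1 HG, subset_trans SH2 HG).
have /and3P[p1 u1 /eqP l1] := q1T; have /and3P[p2 u2 /eqP l2] := q2T.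
have [e1q e1y] := last_edgeP sy l1; have [e2q e2y] := last_edgeP sy l2.
case: (eqVneq (last_edge s q1) (last_edge s q2)) => [<-|ne].
  by move: p1; rewrite pathE => /allP; exact.
have q1R := sub_is_path (tight_residual _ _) q1T.
have q2R := sub_is_path (tight_residual _ _) q2T.
have in_aug S q e : (e \in augment_path S q)
    = (e \in S) && (rev_edge e \notin path_edges s q)
    || (e \in path_edges s q) && (e \in G).
  by rewrite in_augment !inE.
have [f [fF fK wf lev rf]] : exists f, [/\ f \in augment_path S2 q2,
    f \notin augment_path S1 q1, 0 < (edge_weight f).2,
    (psi (last_edge s q1).2).2 <= (psi f.2).2 & reduced edge_weight phi f = 0].
  apply: (exchange antiG (t := t) (k := k)).
  - exact: augment_sub.
  - exact: augment_sub.
  - exact: augment_path_optimal opt1 q1T.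
  - exact: augment_path_optimal opt2 q2T.
  - by move=> a _; rewrite /edge_weight.
  (* The extra units into [y] cancel; what remains is the difference between [k] units into [t] and
     [k] into [y]. *)
  - move=> h; rewrite (augment_path_div SG2 f2 q2R) (augment_path_div SG1 f1 q1R).
    by rewrite e1y [RHS]addrAC -mulrnDl subrKA.
  - by rewrite in_aug e1q; case/setDP: new1 => ->; rewrite orbT.
  - rewrite in_aug negb_or negb_and; apply/andP; split.
      by case/setDP: new1 => _ /(contra (subsetP SH2 _))->.
    apply: contra ne => /andP[e1q2 _]; apply/eqP/into_last => //.
    by rewrite l2.
  - by rewrite /edge_weight new1.
have {}wf : f \in G :\: H by move: wf; rewrite /edge_weight /=; case: (f \in _).
have [fG fH] := setDP wf.
have fq2 : f \in path_edges s q2.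
  move: fF; rewrite in_aug => /orP[/andP[/(subsetP SH2)]|/andP[]//].
  by rewrite (negPf fH).
suff fe2 : f = last_edge s q2.
  have fS1 := contra (subsetP SH1 f) fH.
  rewrite -fe2 inE in_residual fG fS1 /residual_weight.
  by rewrite (contraNF (subsetP SG1 _)) ?rev_notin // rf eqxx.
(* An earlier edge would have its head at a level at most that of the tail of the last edge, one
   below the level of [y]. *)
move: fq2 p2 new2 l2; case: (lastP q2) => // r z.
rewrite last_edge_rcons path_edges_rcons mem_rcons inE last_rcons rcons_path.
case/orP=> [/eqP//|/path_edges_head fr] /andP[pr zT] new zy.
have := tight_path_level SH2 pr (mem_behead (s := s :: r) fr).
have := tight_level SH2 zT; rewrite new /= zy.
by move=> lvl_z lvl_f; have := le_trans lev lvl_f; rewrite e1y lvl_z gerDl.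
Qed.

End ShortestPaths.

(** * The construction *)

Section Step.
Variables (R : realDomainType) (T : finType) (G : {set T * T}).
Variables (c : T * T -> R) (s : T) (H : {set T * T}) (k p : nat).
Hypotheses (antiG : antisymmetric_digraph G) (HG : H \subset G).
Hypotheses (c_ge0 : forall a, a \in G -> 0 <= c a).
Hypotheses (Gp : edge_outconnected G s p) (kp : (k < p)%N).
Hypothesis in_degH : forall v, v != s -> in_degree H v = k.
Variables (S : T -> {set T * T}) (q : T -> seq T).
Hypothesis Smin : forall t, t != s -> min_edge_set c G H s t k (S t).
Hypothesis q_min : forall t, t != s -> lex_min_path c G H (S t) s t (q t).

Let H' := H :|: [set last_edge s (q t) | t in [set~ s]].

Lemma chosen_edge_new t : t != s ->
  last_edge s (q t) \in G :\: H /\ (last_edge s (q t)).2 = t.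
Proof.
move=> ts; apply: (last_edge_new ts (Smin ts)); first exact: in_degH.
by case: (q_min ts).
Qed.

Lemma step_sub : H' \subset G.
Proof.
rewrite subUset HG; apply/subsetP => a /imsetP[t]; rewrite !inE => ts ->.
by case: (chosen_edge_new ts) => /setDP[].
Qed.

Lemma step_in_degree v : v != s -> in_degree H' v = k.+1.
Proof.
move=> vs; have [/setDP[_ eH] ev] := chosen_edge_new vs.
rewrite /in_degree -(in_degH vs) -add1n.
rewrite -[1%N]/(nat_of_bool true).
have <- : last_edge s (q v) \notin [set a in H | a.2 == v].
  by rewrite inE (negPf eH).
rewrite -cardsU1; apply: eq_card => a; rewrite !inE.
apply/andP/orP => [[/orP[aH|/imsetP[t + aE]] av]|[/eqP->|/andP[-> ->//]]].
- by right; rewrite aH.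
- rewrite !inE => ts; left; have [_ et] := chosen_edge_new ts.
  by move: av; rewrite aE et => /eqP->.
- rewrite ev eqxx; split=> //; apply/orP; right.
  by apply/imsetP; exists v; rewrite ?inE.
Qed.

Lemma step_in_degree_source : in_degree H s = 0%N -> in_degree H' s = 0%N.
Proof.
move=> Hs; rewrite -Hs; apply: eq_card => a; rewrite !inE.
case aH: (a \in H) => //=; apply/negbTE/negP => /andP[/imsetP[t]].
rewrite !inE => ts -> /eqP es; have [_ et] := chosen_edge_new ts.
by rewrite -et es eqxx in ts.
Qed.

(* Induction on the number of new edges on a shortest path: a new edge into [y]
   on it can be exchanged for the edge chosen for [y], the tail of which is
   reached by a shortest path with one new edge fewer. *)
Lemma reach_in_step t phi : t != s -> optimal G (edge_weight G c H) (S t) phi ->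
  phi s = 0 -> (forall v, exists r, is_path (tight G c H phi (S t)) s v r) ->
  exists r, is_path (tight G c H phi (S t) :&: ~: (G :\: H')) s t r.
Proof.
move=> ts opt phi_s tight_reach.
have SH := min_edge_set_sub (Smin ts).
pose A := tight G c H phi (S t); pose e u v := (u, v) \in A :&: ~: (G :\: H').
(* Outer induction on a strict bound [n] for the level of the endpoint, inner induction on the
   path. *)
suff reach n r : is_path A s (last s r) r -> (phi (last s r)).2 < n%:Z ->
    connect e s (last s r).
  have [r0 r0P] := tight_reach t; have /and3P[_ _ /eqP lr0] := r0P.
  have /connectP[r1 r1P lr1] : connect e s t.
    rewrite -lr0; apply: (reach `|(phi t).2|.+1%N); rewrite lr0 //.
    by apply: le_lt_trans (lez_abs _) _; rewrite ltz_nat.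
  case: (shortenP r1P) lr1 => r rP ur _ lr.
  by exists r; apply/and3P; split=> //; apply/eqP.
elim: n r => [|n IHn] r.
  (* Levels start at 0 and never decrease along a tight path. *)
  move=> /and3P[rA _ _]; have := tight_path_level antiG HG SH rA (mem_head _ _).
  by rewrite phi_s /= => /le_lt_trans H0 /H0.
elim/last_ind: r => [|r y IHr]; first by rewrite connect0.
rewrite last_rcons => ryA lvl; have /and3P[] := ryA.
rewrite rcons_path => /andP[rA yA]; rewrite -rcons_cons rcons_uniq => /andP[yr ur] _.
have lvl_y := tight_level antiG HG SH yA.
have reach_r : connect e s (last s r).
  apply: IHr; first by apply/and3P; split.
  by apply: le_lt_trans lvl; rewrite lvl_y lerDl.
case: (boolP ((last s r, y) \in G :\: H')) => [new'|old'].
  have new : (last s r, y) \in G :\: H.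
    by apply: subsetP new'; apply: setDS; exact: subsetUl.
  have ys : y != s by apply: contraNneq yr => ->; rewrite mem_head.
  have sy : s != y by rewrite eq_sym.
  have [psi [opt_psi _ psi_tight]] :=
    tight_potential antiG HG c_ge0 ys (Smin ys) kp Gp.
  have qyT := psi_tight _ _ (q_min ys).
  have [eyGH ey] := chosen_edge_new ys.
  have eyA : last_edge s (q y) \in A.
    apply: (last_edge_exchange antiG HG SH (min_edge_set_sub (Smin ys))
      (min_edge_set_flow (Smin ts)) (min_edge_set_flow (Smin ys))
      opt opt_psi sy ryA qyT _ eyGH).
    by rewrite last_edge_rcons.
  have lvl_e := tight_level antiG HG SH eyA; rewrite ey eyGH in lvl_e.
  have [r' r'A] := tight_reach (last_edge s (q y)).1.
  have /and3P[_ _ /eqP lr'] := r'A.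
  have reach_r' : connect e s (last_edge s (q y)).1.
    rewrite -lr'; apply: IHn; rewrite lr' //.
    by move: lvl; rewrite lvl_e -addn1 PoszD ltrD2r.
  apply: connect_trans reach_r' (connect1 _).
  rewrite /e; have -> : ((last_edge s (q y)).1, y) = last_edge s (q y).
    by case: last_edge ey => ? ? /= ->.
  rewrite in_setI eyA in_setC in_setD negb_and negbK inE.
  by apply/orP; left; apply/orP; right; apply: imset_f; rewrite !inE.
apply: connect_trans reach_r (connect1 _).
by rewrite /e in_setI yA in_setC.
Qed.

(** Augmenting [S t] along a tight path without new edges outside [H'] stays inside [H'], and [phi]
    still certifies optimality. *)
Lemma step_min_paths t : t != s -> exists P, min_disjoint_paths c G H' s t k.+1 P.
Proof.
move=> ts; have st : s != t by rewrite eq_sym.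
have SH := min_edge_set_sub (Smin ts); have SG := subset_trans SH HG.
have [phi [opt phi_s phi_tight]] :=
  tight_potential antiG HG c_ge0 ts (Smin ts) kp Gp.
have [r rA] : exists r, is_path (tight G c H phi (S t) :&: ~: (G :\: H')) s t r.
  apply: reach_in_step => // v.
  have [r0 r0P] := residual_reachable HG ts (Smin ts) kp Gp v.
  have [r rP] := lex_min_exists c H r0P.
  by exists r; exact: phi_tight.
have rT := sub_is_path (subsetIl _ _) rA.
have rR := sub_is_path (tight_residual _ _ _ _ _) rT.
pose K := augment_path G s (S t) r.
have KG : K \subset G by exact: augment_sub.
have KH' : K \subset H'.
  apply/subsetP => a; rewrite in_augment => /orP[/andP[/(subsetP SH) aH _]|].
    by rewrite inE aH.
  rewrite inE => /andP[ar aG]; case/and3P: rA; rewrite pathE => /allP/(_ a ar) + _ _.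
  by rewrite /= in_setI !in_setC in_setD aG andbT negbK => /andP[].
have fK : is_flow K s t k.+1.
  move=> V h; rewrite (augment_path_div antiG SG (min_edge_set_flow (Smin ts)) rR).
  by rewrite mulrSr.
have optK := augment_path_optimal antiG SG opt rT.
have [P dP PK] := flow_disjoint_paths st fK.
exists P; split=> [|Q dQ]; first exact: sub_disjoint_paths dP.
rewrite (family_costE _ dP) (family_costE _ dQ).
apply: (@le_trans _ _ (\sum_(a in K) c a)).
  rewrite [leRHS](big_setID (family_edges s P)) /= (setIidPr PK) lerDl.
  by apply: sumr_ge0 => a /setDP[/(subsetP KG) /c_ge0].
have := optimal_min KG (disjoint_paths_sub dQ) optK.
rewrite fK (disjoint_paths_flow dQ) => /(_ erefl) /lex_ge0_fst.
by rewrite /= !sum_fst subr_ge0.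
Qed.

End Step.

(** * Invariants of the whole construction *)

Section Construction.
Variables (R : realDomainType) (T : finType) (G : {set T * T}).
Variables (c : T * T -> R) (s : T) (p : nat).
Hypotheses (antiG : antisymmetric_digraph G).
Hypotheses (c_ge0 : forall a, a \in G -> 0 <= c a).
Hypothesis Gp : edge_outconnected G s p.

(** The in-degrees belong to the invariant because they force the edges chosen in the next step to
    be new. *)
Lemma constructed_inv k H : constructed c G s k H -> (k <= p)%N ->
  [/\ H \subset G, in_degree H s = 0%N,
      forall v, v != s -> in_degree H v = k &
      forall t, t != s -> exists P, min_disjoint_paths c G H s t k P].
Proof.
elim=> [_|{}k {}H H1 _ IH [S [q [Sq ->]]] kp].
  have deg0 v : in_degree (set0 : {set T * T}) v = 0%N.
    by apply: eq_card0 => a; rewrite !inE.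
  split=> // [|t _]; first exact: sub0set.
  exists [::]; split=> // Q /and3P[/nilP-> _ _].
  by rewrite /family_cost !big_nil.
have [HG Hs Hv _] := IH (ltnW kp).
have Smin t ts := (Sq t ts).1; have q_min t ts := (Sq t ts).2.
split.
- exact: (step_sub (k := k) HG Hv Smin q_min).
- exact: (step_in_degree_source (k := k) Hv Smin q_min).
- move=> v; exact: (step_in_degree (k := k) Hv Smin q_min).
- move=> t; exact: (step_min_paths antiG HG c_ge0 Gp kp Hv Smin q_min).
Qed.

End Construction.

Theorem theorem8 (R : realDomainType) (T : finType) (G : {set T * T})
    (c : T * T -> R) (s : T) (p : nat) :
  antisymmetric_digraph G ->
  (forall a, a \in G -> 0 <= c a) ->
  (1 <= p)%N ->
  edge_outconnected G s p ->
  (forall (k : nat) (H : {set T * T}), (k < p)%N -> constructed c G s k H ->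
     forall t, t != s ->
       (exists S, min_edge_set c G H s t k S) /\
       (forall S, min_edge_set c G H s t k S ->
          exists q, lex_min_path c G H S s t q)) /\
  (forall H : {set T * T}, constructed c G s p H ->
     [/\ multipath_preserver c G s p H,
         #|H| = (p * (#|T| - 1))%N,
         in_degree H s = 0%N
       & forall v, v != s -> in_degree H v = p]).
Proof.
move=> antiG c_ge0 _ Gp; split=> [k H kp /(constructed_inv antiG c_ge0 Gp)|H].
  move=> /(_ (ltnW kp)) [HG _ _ Hmin] t ts; split.
    by have [P minP] := Hmin t ts; exists (family_edges s P); exists P.
  move=> S Smin; have [q0 q0P] := residual_reachable HG ts Smin kp Gp t.
  exact: lex_min_exists q0P.
move=> /(constructed_inv antiG c_ge0 Gp) /(_ (leqnn p)) [HG Hs Hv Hmin].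
split=> //.
(* Edges are counted by their heads. *)
rewrite -sum1_card (partition_big snd predT) //= (bigD1 s) //=.
have card_in v : \sum_(a in H | a.2 == v) 1 = in_degree H v :> nat.
  by rewrite sum1_card; apply: eq_card => a; rewrite !inE.
rewrite card_in Hs add0n (eq_bigr (fun=> p)) => [|v /Hv]; last by rewrite card_in.
by rewrite sum_nat_const mulnC subn1 cardC1.
Qed.
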